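(* The following twenty mesh patterns $(12,R)$ are pairwise equidistributed, where $R$ ranges over: $\{(0,2),(1,2),(2,2),(1,1),(2,1),(0,0)\}$, $\{(0,2),(2,2),(0,1),(1,1),(0,0),(1,0)\}$, $\{(1,2),(2,2),(1,1),(2,1),(0,0),(2,0)\}$, $\{(2,2),(0,1),(1,1),(0,0),(1,0),(2,0)\}$, $\{(0,2),(1,2),(2,2),(0,1),(2,1),(1,0)\}$, $\{(0,2),(1,2),(0,1),(2,1),(0,0),(1,0)\}$, $\{(1,2),(2,2),(0,1),(2,1),(1,0),(2,0)\}$, $\{(1,2),(0,1),(2,1),(0,0),(1,0),(2,0)\}$, $\{(0,2),(1,2),(0,1),(1,1),(2,1),(2,0)\}$, $\{(0,2),(1,2),(0,1),(1,1),(1,0),(2,0)\}$, $\{(0,2),(1,2),(1,1),(2,1),(1,0),(2,0)\}$, $\{(0,2),(0,1),(1,1),(2,1),(1,0),(2,0)\}$, $\{(0,2),(1,2),(2,2),(1,1),(0,0),(2,0)\}$, $\{(0,2),(2,2),(0,1),(1,1),(0,0),(2,0)\}$, $\{(0,2),(2,2),(1,1),(2,1),(0,0),(2,0)\}$, $\{(0,2),(2,2),(1,1),(0,0),(1,0),(2,0)\}$, $\{(0,2),(1,2),(0,1),(2,1),(0,0),(2,0)\}$, $\{(0,2),(1,2),(2,2),(0,1),(1,0),(2,0)\}$, $\{(0,2),(2,2),(0,1),(2,1),(1,0),(2,0)\}$, $\{(0,2),(1,2),(2,1),(0,0),(1,0),(2,0)\}$. Moreover, for each such pattern $p$, with $F(x)=\sum_{n\ge0}n!x^n$,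 $A(x)=\sum_{n\ge0}s_{n,0}(p)x^n$ and $F(x,q)=\sum_{n\ge0}x^n\sum_{\pi\in S_n}q^{p(\pi)}$, $$A(x)=\frac{(1+x)F(x)}{1+xF(x)},\qquad F(x,q)=\frac{(1+x(1-q))F(x)}{1+x(1-q)F(x)}.$$
   Context: For $R\subseteq\{0,1,2\}^2$ and $\pi=\pi_1\cdots\pi_n\in S_n$, an occurrence of the mesh pattern $(12,R)$ in $\pi$ is a pair of positions $i_1<i_2$ with $\pi_{i_1}<\pi_{i_2}$ such that, setting $x_0=0,x_1=i_1,x_2=i_2,x_3=n+1$ and $y_0=0,y_1=\pi_{i_1},y_2=\pi_{i_2},y_3=n+1$, for every $(a,b)\in R$ there is no index $k$ with $x_a<k<x_{a+1}$ and $y_b<\pi_k<y_{b+1}$. $p(\pi)$ is the number of occurrences of $p$ in $\pi$; $s_{n,k}(p)$ the number of $\pi\in S_n$ with $p(\pi)=k$; $p_1,p_2$ are equidistributed if $s_{n,k}(p_1)=s_{n,k}(p_2)$ for all $n,k\ge 0$. Generating functions are formal power series. *)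

(* Defs.v *)
From mathcomp Require Import all_boot all_order all_algebra.
From mathcomp Require Import perm.

Set Implicit Arguments.
Unset Strict Implicit.
Unset Printing Implicit Defensive.

Import GRing.Theory.

Section MeshPatterns.

Local Open Scope nat_scope.

Definition shading := {set 'I_3 * 'I_3}.

(* Positions and values of pi : 'S_n are numbered from 0 in 'I_n; the
   coordinates below shift them by 1, so that they range over 1, ..., n and
   0 and n.+1 bound the grid. *)
Definition mesh_x n (i1 i2 : 'I_n) (a : nat) : nat :=
  nth 0 [:: 0; i1.+1; i2.+1; n.+1] a.

Definition mesh_y n (pi : 'S_n) (i1 i2 : 'I_n) (b : nat) : nat :=
  nth 0 [:: 0; (pi i1).+1; (pi i2).+1; n.+1] b.

Definition mesh12_occ (R : shading) n (pi : 'S_n) (i1 i2 : 'I_n) : bool :=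
  [&& i1 < i2, pi i1 < pi i2 &
    [forall ab in R, ~~ [exists k : 'I_n,
       (mesh_x i1 i2 ab.1 < k.+1 < mesh_x i1 i2 ab.1.+1) &&
       (mesh_y pi i1 i2 ab.2 < (pi k).+1 < mesh_y pi i1 i2 ab.2.+1)]]].

Definition mesh12_count (R : shading) n (pi : 'S_n) : nat :=
  #|[set i : 'I_n * 'I_n | mesh12_occ R pi i.1 i.2]|.

Definition mesh12_num (R : shading) (n k : nat) : nat :=
  #|[set pi : 'S_n | mesh12_count R pi == k]|.

Definition equidistributed (R1 R2 : shading) : Prop :=
  forall n k, mesh12_num R1 n k = mesh12_num R2 n k.

Let o0 : 'I_3 := @Ordinal 3 0 isT.
Let o1 : 'I_3 := @Ordinal 3 1 isT.
Let o2 : 'I_3 := @Ordinal 3 2 isT.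

Definition twenty_shadings : seq shading := [::
  [set (o0, o2); (o1, o2); (o2, o2); (o1, o1); (o2, o1); (o0, o0)];
  [set (o0, o2); (o2, o2); (o0, o1); (o1, o1); (o0, o0); (o1, o0)];
  [set (o1, o2); (o2, o2); (o1, o1); (o2, o1); (o0, o0); (o2, o0)];
  [set (o2, o2); (o0, o1); (o1, o1); (o0, o0); (o1, o0); (o2, o0)];
  [set (o0, o2); (o1, o2); (o2, o2); (o0, o1); (o2, o1); (o1, o0)];
  [set (o0, o2); (o1, o2); (o0, o1); (o2, o1); (o0, o0); (o1, o0)];
  [set (o1, o2); (o2, o2); (o0, o1); (o2, o1); (o1, o0); (o2, o0)];
  [set (o1, o2); (o0, o1); (o2, o1); (o0, o0); (o1, o0); (o2, o0)];
  [set (o0, o2); (o1, o2); (o0, o1); (o1, o1); (o2, o1); (o2, o0)];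
  [set (o0, o2); (o1, o2); (o0, o1); (o1, o1); (o1, o0); (o2, o0)];
  [set (o0, o2); (o1, o2); (o1, o1); (o2, o1); (o1, o0); (o2, o0)];
  [set (o0, o2); (o0, o1); (o1, o1); (o2, o1); (o1, o0); (o2, o0)];
  [set (o0, o2); (o1, o2); (o2, o2); (o1, o1); (o0, o0); (o2, o0)];
  [set (o0, o2); (o2, o2); (o0, o1); (o1, o1); (o0, o0); (o2, o0)];
  [set (o0, o2); (o2, o2); (o1, o1); (o2, o1); (o0, o0); (o2, o0)];
  [set (o0, o2); (o2, o2); (o1, o1); (o0, o0); (o1, o0); (o2, o0)];
  [set (o0, o2); (o1, o2); (o0, o1); (o2, o1); (o0, o0); (o2, o0)];
  [set (o0, o2); (o1, o2); (o2, o2); (o0, o1); (o1, o0); (o2, o0)];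
  [set (o0, o2); (o2, o2); (o0, o1); (o2, o1); (o1, o0); (o2, o0)];
  [set (o0, o2); (o1, o2); (o2, o1); (o0, o0); (o1, o0); (o2, o0)]].

End MeshPatterns.

Local Open Scope ring_scope.

(* A formal power series in x is its sequence of coefficients; equality of
   series is the pointwise equality =1. *)
Definition fps (K : Type) := nat -> K.

Declare Scope fps_scope.
Delimit Scope fps_scope with fps.
Bind Scope fps_scope with fps.

Section FormalPowerSeries.

Variable K : comUnitRingType.
Implicit Types a b : fps K.

Definition fps_const (c : K) : fps K := fun n => if n == 0%N then c else 0.

Definition fps_X : fps K := fun n => if n == 1%N then 1 else 0.

Definition fps_add a b : fps K := fun n => a n + b n.

Definition fps_mul a b : fps K := fun n => \sum_(i < n.+1) a i * b (n - i)%N.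

(* fps_inv_seq a n lists the first n coefficients of 1/a; it is meaningful
   when a 0 is a unit of K. *)
Fixpoint fps_inv_seq a (n : nat) : seq K :=
  if n is m.+1 then
    let s := fps_inv_seq a m in
    rcons s (if m is 0 then (a 0)^-1
             else - (a 0)^-1 * \sum_(i < m) a (m - i)%N * s`_i)
  else [::].

Definition fps_inv a : fps K := fun n => (fps_inv_seq a n.+1)`_n.

Definition fps_div a b : fps K := fps_mul a (fps_inv b).

Lemma size_fps_inv_seq a n : size (fps_inv_seq a n) = n.
Proof. by elim: n => //= n IHn; rewrite size_rcons IHn. Qed.

Lemma nth_fps_inv_seq a n i : (i < n)%N -> (fps_inv_seq a n)`_i = fps_inv a i.
Proof.
elim: n => // n IHn; rewrite ltnS leq_eqVlt => /predU1P[-> // | lt_i_n].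
by rewrite /= nth_rcons size_fps_inv_seq lt_i_n IHn.
Qed.

Lemma fps_mulV a : a 0%N \is a GRing.unit ->
  fps_mul a (fps_inv a) =1 fps_const 1.
Proof.
move=> Ua [|n]; rewrite /fps_mul /fps_const /=.
  by rewrite big_ord_recl big_ord0 addr0 /fps_inv /= divrr.
rewrite big_ord_recl subn0.
have -> : fps_inv a n.+1 =
    - (a 0%N)^-1 * \sum_(i < n.+1) a (n.+1 - i)%N * fps_inv a i.
  rewrite {1}/fps_inv -[fps_inv_seq _ _]/(rcons (fps_inv_seq a n.+1) _).
  rewrite nth_rcons size_fps_inv_seq ltnn eqxx; congr (_ * _).
  by apply: eq_bigr => i _; rewrite -(@nth_fps_inv_seq a n.+1).
rewrite mulrA mulrN divrr // mulN1r; apply/eqP.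
rewrite addrC subr_eq0; apply/eqP; rewrite (reindex_inj rev_ord_inj) /=.
apply: eq_bigr => i _; rewrite /bump /= add1n subSS.
by rewrite !subSS subKn ?subnSK // -1?ltnS // subSn // -ltnS.
Qed.

End FormalPowerSeries.

Arguments fps_X {K}.

Notation "a + b" := (fps_add a b) : fps_scope.
Notation "a * b" := (fps_mul a b) : fps_scope.
Notation "a / b" := (fps_div a b) : fps_scope.
Notation "1" := (fps_const 1%R) : fps_scope.

Definition fact_gf (K : comUnitRingType) : fps K := fun n => (n`!)%:R.
Arguments fact_gf {K}.

Definition avoid_gf (R : shading) : fps int := fun n => (mesh12_num R n 0)%:R.

(* The variable q is 'X : {poly int}. *)
Definition mesh12_gf (R : shading) : fps {poly int} :=
  fun n => \sum_(pi : 'S_n) 'X ^+ mesh12_count R pi.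

(* Main.v *)
(* Call k a strong fixed point of a permutation pi of {0, ..., n-1} if pi k = k
   and pi maps {0, ..., k-1} to itself, and let H_n(q) be the sum of
   q ^ #{strong fixed points k > 0} over the permutations of size n.
   Telescoping 1 - q^c over the c strong fixed points of pi, and cutting pi at
   each of them into a pair of permutations of sizes k and n-k-1, gives
     n! - H_n = (1 - q) * sum_(1 <= k < n) H_k (n-k-1)!,
   which is the functional equation of F(x, q); A(x) is the case q = 0.
   Transposition (pi |-> pi^-1) and half-turn (reverse-complement) split the
   twenty shadings into five orbits.  In each orbit one shading has its
   occurrences in bijection with the nonzero strong fixed points of f(pi), for
   a bijection f of S_n. *)
Require Import Defs.
From mathcomp Require Import all_boot all_order all_algebra perm.
From mathcomp Require Import zify.

Set Implicit Arguments.
Unset Strict Implicit.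
Unset Printing Implicit Defensive.

Import GRing.Theory.
Local Open Scope ring_scope.

(** * Division of formal power series *)

Section FpsDivision.

Variable K : comUnitRingType.
Implicit Types a b c : fps K.

(** Coefficient [n] of a product sees only coefficients up to [n], so series may be truncated to
    polynomials; ring laws such as associativity are inherited from there. *)
Lemma fps_mul_coef a b N n : (n < N)%N ->
  fps_mul a b n = ((\poly_(i < N) a i) * (\poly_(i < N) b i))`_n.
Proof.
move=> ltnN; rewrite coefM; apply: eq_bigr => i _.
by rewrite !coef_poly !ifT //; have := ltn_ord i; lia.
Qed.

Lemma fps_mul_ext a a' b b' : a =1 a' -> b =1 b' -> fps_mul a b =1 fps_mul a' b'.
Proof. by move=> eqa eqb n; apply: eq_bigr => i _; rewrite eqa eqb. Qed.

Lemma fps_mulA a b c : fps_mul a (fps_mul b c) =1 fps_mul (fps_mul a b) c.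
Proof.
move=> n; rewrite {1}/fps_mul {2}/fps_mul.
pose P d := \poly_(i < n.+1) (d : fps K) i.
transitivity ((P a * (P b * P c))`_n).
  rewrite coefM; apply: eq_bigr => i _.
  rewrite (@fps_mul_coef b c n.+1) ?coef_poly ?ltn_ord //.
  by rewrite ltnS leq_subr.
rewrite mulrA coefM; apply: eq_bigr => i _.
by rewrite (@fps_mul_coef a b n.+1) // coef_poly ltnS leq_subr.
Qed.

Lemma fps_mulr1 a : fps_mul a (fps_const 1) =1 a.
Proof.
move=> n; rewrite /fps_mul big_ord_recr /= subnn mulr1 big1 ?add0r // => i _.
by rewrite /fps_const ifF ?mulr0 //; apply/negbTE; rewrite subn_eq0 -ltnNge.
Qed.

Lemma fps_divE a b c : b 0%N \is a GRing.unit ->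
  fps_mul a b =1 c -> a =1 fps_div c b.
Proof.
move=> Ub eqc n; rewrite -[LHS]fps_mulr1.
rewrite (fps_mul_ext (frefl a) (fsym (fps_mulV Ub))) fps_mulA.
by apply: fps_mul_ext.
Qed.

End FpsDivision.

(** * Strong fixed points *)

Section StrongFixedPoints.

Local Open Scope nat_scope.

(** Here [k] is a natural number, so that one [k] can be tested on permutations of different sizes.
    For [k < n] the condition at [j = k] forces [pi k = k]; for [k >= n] it is vacuous, hence the
    bound [k < n] in later sums. *)
Definition sfp n (pi : 'S_n) (k : nat) : bool :=
  [forall j : 'I_n, ((pi j < k) == (j < k)) && ((k < pi j) == (k < j))].

Lemma sfpP n (pi : 'S_n) k :
  reflect (forall j : 'I_n, (pi j < k) = (j < k) /\ (k < pi j) = (k < j))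
          (sfp pi k).
Proof.
apply: (iffP forallP) => H j.
  by have /andP[/eqP-> /eqP->] := H j.
by have [-> ->] := H j; rewrite !eqxx.
Qed.

Lemma ord_ltNge n (i j : 'I_n) : i != j -> (i < j) = ~~ (j < i).
Proof. by move=> neij; rewrite ltn_neqAle leqNgt (inj_eq val_inj) neij. Qed.

Lemma card_ord_lt n (k : 'I_n) : #|[set j : 'I_n | j < k]| = k.
Proof.
have inj : injective (fun j : 'I_k => widen_ord (ltnW (ltn_ord k)) j).
  by move=> i j [] /val_inj.
rewrite -[RHS]card_ord -(card_imset _ inj); apply: eq_card => j; rewrite !inE.
apply/idP/imsetP => [ltjk | [i _ ->] /=]; last exact: ltn_ord.
by exists (Ordinal ltjk) => //; apply: val_inj.
Qed.

(** A [pi] that preserves comparisons with [k] maps the points below [k] onto those below [pi k];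
    counting both sets gives [pi k = k]. *)
Lemma sfp_ordP n (pi : 'S_n) (k : 'I_n) :
  reflect (forall j, j != k -> (k < j) = (pi k < pi j)) (sfp pi k).
Proof.
apply: (iffP idP) => [/sfpP H j _ | H].
  have [h1 h2] := H k; have [h3 h4] := H j.
  by have <- : k = pi k :> nat; lia.
have H' j : (pi j < pi k) = (j < k).
  have [->|nejk] := eqVneq j k; first by rewrite !ltnn.
  rewrite !ltnNge !(leq_eqVlt k) !(leq_eqVlt (pi k)) -H //.
  by rewrite !(inj_eq val_inj) (inj_eq perm_inj).
have Ek : k = pi k :> nat.
  rewrite -[LHS]card_ord_lt -[RHS]card_ord_lt.
  rewrite -(card_preimset [set j : 'I_n | j < pi k] (@perm_inj _ pi)).
  by apply: eq_card => j; rewrite !inE H'.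
apply/sfpP => j; split; first by rewrite [in LHS]Ek H'.
rewrite [in LHS]Ek; have [->|nejk] := eqVneq j k; first by rewrite !ltnn.
by rewrite H.
Qed.

Definition sfp_count n (pi : 'S_n) : nat := \sum_(1 <= k < n) sfp pi k.

End StrongFixedPoints.

(** * The series of strong fixed points and the telescoping identity *)

Section StrongFixedPointSeries.

Variables (K : comUnitRingType) (q : K).

Definition sfp_gf (n : nat) : K := \sum_(pi : 'S_n) q ^+ sfp_count pi.

(** Each [k] with [b k] contributes the difference of [q ^+ c] and [q ^+ c.+1], where [c] counts the
    earlier hits. *)
Lemma one_sub_exp_count (b : nat -> bool) n :
  1 - q ^+ (\sum_(1 <= k < n) b k) =
  (1 - q) * \sum_(1 <= k < n | b k) q ^+ (\sum_(1 <= j < k) b j).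
Proof.
case: n => [|n]; first by rewrite !big_geq // mulr0 expr0 subrr.
rewrite [in RHS]big_mkcond.
elim: n => [|n IHn]; first by rewrite !big_geq // mulr0 expr0 subrr.
rewrite !(@big_nat_recr _ _ _ n.+1) //= mulrDr -IHn.
case: (b n.+1); last by rewrite addn0 mulr0 addr0.
by rewrite addn1 exprSr mulrBl mul1r mulrC; rewrite [q * _]mulrC addrA subrK.
Qed.

End StrongFixedPointSeries.

(** * Cutting a permutation at a strong fixed point *)

Section Join.

Variables (k m : nat).
Local Open Scope nat_scope.

(** The direct sum of [a], one point and [b]: the lift of [b] fixes [ord0], which becomes the point
    [k]. *)
Definition join_fun (a : 'S_k) (b : 'S_m) (i : 'I_(k + m.+1)) : 'I_(k + m.+1) :=
  match split i with
  | inl j => lshift m.+1 (a j)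
  | inr j => rshift k (lift_perm ord0 ord0 b j)
  end.

Lemma join_inj a b : injective (join_fun a b).
Proof.
move=> i j; rewrite /join_fun.
case: (split_ordP i) => i' ->; case: (split_ordP j) => j' ->.
- by move/lshift_inj/perm_inj->.
- by move/eqP; rewrite eq_lrshift.
- by move/eqP; rewrite eq_rlshift.
- by move/rshift_inj/perm_inj->.
Qed.

Definition join (ab : 'S_k * 'S_m) : 'S_(k + m.+1) := perm (@join_inj ab.1 ab.2).

Lemma join_lE ab i : join ab (lshift _ i) = lshift _ (ab.1 i).
Proof. by rewrite permE /join_fun (unsplitK (inl i)). Qed.

Lemma join_rE ab i : join ab (rshift _ i) = rshift _ (lift_perm ord0 ord0 ab.2 i).
Proof. by rewrite permE /join_fun (unsplitK (inr i)). Qed.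

Lemma join_injective : injective join.
Proof.
move=> [a b] [a' b'] E; congr (_, _); apply/permP => i.
  by apply: (@lshift_inj _ m.+1); rewrite -(join_lE (a, b)) -(join_lE (a', b')) E.
apply: (@lift_inj _ ord0); apply: (@rshift_inj k).
rewrite -!(lift_perm_lift ord0 ord0) -(join_rE (a, b)) -(join_rE (a', b')).
by rewrite E.
Qed.

Lemma sfp_join ab : sfp (join ab) k.
Proof.
apply/sfpP => j; case: (split_ordP j) => i ->.
  rewrite join_lE /=; have := ltn_ord i; have := ltn_ord (ab.1 i); lia.
rewrite join_rE /=; case: (unliftP ord0 i) => [i' ->|->].
  rewrite lift_perm_lift /=; rewrite /bump; lia.
by rewrite lift_perm_id /=; lia.
Qed.

(** The points from [k] on stay above [j] under [join], so only the left block imposes a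
    condition. *)
Lemma sfp_join_lt ab j : j < k -> sfp (join ab) j = sfp ab.1 j.
Proof.
move=> ltjk; apply/sfpP/sfpP => H i.
  by have := H (lshift m.+1 i); rewrite join_lE.
case: (split_ordP i) => i' ->; first by rewrite join_lE; apply: H.
by rewrite join_rE /=; lia.
Qed.

Lemma sfp_join_surj pi : sfp pi k -> exists ab, pi = join ab.
Proof.
move=> /sfpP H.
have Ha (i : 'I_k) : pi (lshift m.+1 i) < k.
  by have [-> _] := H (lshift m.+1 i) => /=.
have Hb (i : 'I_m) : pi (rshift k (lift ord0 i)) - k.+1 < m.
  have [_] := H (rshift k (lift ord0 i)); rewrite /= /bump.
  have := ltn_ord i; have := ltn_ord (pi (rshift k (lift ord0 i))).
  lia.
have Hb' (i : 'I_m) : k < pi (rshift k (lift ord0 i)).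
  have [_] := H (rshift k (lift ord0 i)); rewrite /= /bump; lia.
have ia : injective (fun i => Ordinal (Ha i)).
  by move=> i j [] /val_inj/perm_inj/lshift_inj.
have ib : injective (fun i => Ordinal (Hb i)).
  move=> i j [] E; apply: (@lift_inj _ ord0); apply: (@rshift_inj k).
  apply: (@perm_inj _ pi); apply: val_inj => /=.
  have := Hb' i; have := Hb' j; lia.
exists (perm ia, perm ib); apply/permP => i; apply: val_inj.
case: (split_ordP i) => j ->; first by rewrite join_lE /= permE.
rewrite join_rE; case: (unliftP ord0 j) => [i' ->|->].
  by rewrite lift_perm_lift /= permE /= /bump; have := Hb' i'; lia.
rewrite lift_perm_id /= addn0; have := H (rshift k ord0); rewrite /=; lia.
Qed.

End Join.


(** * The recurrence and its functional equation *)

Section StrongFixedPointRecurrence.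

Variables (K : comUnitRingType) (q : K).

(** [join] is a bijection onto the permutations with strong fixed point [k], and the exponent
    depends only on its left block; the right block is free. Stating the size as an equation avoids
    casts between types ['S_n]. *)
Lemma sum_sfp k m n : n = (k + m.+1)%N ->
  \sum_(pi : 'S_n | sfp pi k) q ^+ (\sum_(1 <= j < k) sfp pi j) =
  sfp_gf q k * (m`!)%:R.
Proof.
move=> ->.
transitivity (\sum_(pi in [set join ab | ab in [set: 'S_k * 'S_m]])
    q ^+ (\sum_(1 <= j < k) sfp pi j)).
  apply: eq_bigl => pi; apply/idP/imsetP => [/sfp_join_surj[ab ->] | [ab _ ->]].
    by exists ab.
  exact: sfp_join.
rewrite big_imset /=; last by move=> ab ab' _ _; apply: join_injective.
transitivity (\sum_(ab : 'S_k * 'S_m) q ^+ sfp_count ab.1).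
  apply: eq_big => [ab | ab _]; first by rewrite inE.
  by congr (_ ^+ _); apply: eq_big_nat => j /andP[_ ltjk]; rewrite sfp_join_lt.
rewrite -(pair_bigA _ (fun (a : 'S_k) (b : 'S_m) => q ^+ sfp_count a)) /=.
rewrite /sfp_gf mulr_suml; apply: eq_bigr => a _.
by rewrite sumr_const card_Sn mulr_natr.
Qed.

Lemma sfp_gf0 : sfp_gf q 0 = 1.
Proof.
rewrite /sfp_gf (eq_bigr (fun=> 1)); last first.
  by move=> pi _; rewrite /sfp_count big_geq.
by rewrite sumr_const card_Sn.
Qed.

Lemma sfp_gf_rec n :
  (n`!)%:R = sfp_gf q n + (1 - q) * \sum_(1 <= k < n) sfp_gf q k * ((n - k.+1)`!)%:R.
Proof.
apply/eqP; rewrite addrC -subr_eq; apply/eqP.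
transitivity (\sum_(pi : 'S_n) (1 - q ^+ sfp_count pi)).
  by rewrite sumrB sumr_const card_Sn.
rewrite (eq_bigr _ (fun pi _ => one_sub_exp_count q (sfp pi) n)) -mulr_sumr.
congr (_ * _); rewrite (exchange_big_dep xpredT) //=.
apply: eq_big_nat => k /andP[_ ltkn]; apply: sum_sfp.
by rewrite -addSnnS subnKC.
Qed.

(** [T] is the series x(1-q), given by its coefficients so that the two ways of writing it in the
    final formulas are both covered. *)
Lemma sfp_gf_series (T : fps K) :
    T =1 (fun n => if n == 1%N then 1 - q else 0) ->
  sfp_gf q =1 ((1 + T) * fact_gf / (1 + T * fact_gf))%fps.
Proof.
move=> eqT.
have T0 : (T * fact_gf)%fps 0%N = 0.
  by rewrite /fps_mul big_ord1 eqT mul0r.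
have TS n : (T * fact_gf)%fps n.+1 = (1 - q) * (n`!)%:R.
  rewrite /fps_mul big_ord_recl eqT mul0r add0r big_ord_recl eqT /= subSS subn0.
  by rewrite big1 ?addr0 // => i _; rewrite eqT mul0r.
apply: fps_divE; first by rewrite /fps_add T0 addr0 unitr1.
move=> n; transitivity ((n`!)%:R + (T * fact_gf)%fps n); last first.
  rewrite /fps_mul /fps_add -[in RHS](eq_bigr _ (fun _ _ => esym (mulrDl _ _ _))).
  rewrite big_split /=; congr (_ + _).
  rewrite big_ord_recl mul1r big1 ?addr0 ?subn0 // => i _.
  by rewrite /fps_const /= mul0r.
transitivity (sfp_gf q n + \sum_(i < n) sfp_gf q i * (T * fact_gf)%fps (n - i)%N).
  rewrite {1}/fps_mul (eq_bigr _ (fun _ _ => mulrDr _ _ _)) big_split.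
  congr (_ + _); first exact: fps_mulr1.
  by rewrite big_ord_recr /= subnn T0 mulr0 addr0.
case: n => [|n]; first by rewrite big_ord0 T0 sfp_gf0.
rewrite TS sfp_gf_rec -addrA; congr (_ + _).
rewrite -(big_mkord xpredT (fun i => sfp_gf q i * (T * fact_gf)%fps (n.+1 - i)%N)).
(* As [sfp_gf q 0 = 1], the term of index 0 is the coefficient of [T * fact_gf]; the others form the
   sum of the recurrence. *)
rewrite big_ltn // subn0 TS sfp_gf0 mul1r addrC mulr_sumr; congr (_ + _).
apply: eq_big_nat => i /andP[_ ltin]; rewrite subSn // TS subSS.
by rewrite mulrCA.
Qed.

End StrongFixedPointRecurrence.

(** * Mesh occurrences, their symmetries and their boolean form *)

Section MeshOccurrences.

Local Open Scope nat_scope.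

(** Strips of the grid in zero-based coordinates; the outer bounds hold for every index and are
    dropped. *)
Definition in_gap (u v w a : nat) : bool :=
  match a with 0 => w < u | 1 => u < w < v | _ => v < w end.

Lemma mesh12_occE (R : shading) n (pi : 'S_n) (i1 i2 : 'I_n) :
  mesh12_occ R pi i1 i2 =
  [&& i1 < i2, pi i1 < pi i2 &
    [forall ab in R, forall k : 'I_n,
      ~~ (in_gap i1 i2 k ab.1 && in_gap (pi i1) (pi i2) (pi k) ab.2)]].
Proof.
congr [&& _, _ & _]; apply: eq_forallb => ab; congr (_ ==> _).
rewrite negb_exists; apply: eq_forallb => k; congr (~~ (_ && _)).
  case: ab => -[[|[|[|//]]] ?] b; rewrite /mesh_x /= !ltnS ?ltn_ord ?andbT //.
case: ab => a -[[|[|[|//]]] ?]; rewrite /mesh_y /= !ltnS ?ltn_ord ?andbT //.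
Qed.

Lemma mesh12_occP (R : shading) n (pi : 'S_n) (i1 i2 : 'I_n) :
  reflect [/\ i1 < i2, pi i1 < pi i2 & forall ab (k : 'I_n), ab \in R ->
             ~~ (in_gap i1 i2 k ab.1 && in_gap (pi i1) (pi i2) (pi k) ab.2)]
          (mesh12_occ R pi i1 i2).
Proof.
rewrite mesh12_occE; apply: (iffP and3P) => -[-> -> H]; split=> //.
  by move=> ab k abR; move/forall_inP/(_ ab abR)/forallP: H; apply.
by apply/forall_inP => ab abR; apply/forallP => k; apply: H.
Qed.

Definition shading_transpose (R : shading) : shading :=
  [set ab | (ab.2, ab.1) \in R].

Definition shading_rotate (R : shading) : shading :=
  [set ab | (rev_ord ab.1, rev_ord ab.2) \in R].

Lemma shading_transposeK : involutive shading_transpose.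
Proof. by move=> R; apply/setP => -[a b]; rewrite !inE. Qed.

Lemma shading_rotateK : involutive shading_rotate.
Proof. by move=> R; apply/setP => -[a b]; rewrite !inE !rev_ordK. Qed.

(** Inversion exchanges positions and values, hence the two coordinates of each box. One implication
    suffices, since both operations are involutions. *)
Lemma mesh12_occ_transpose R n (pi : 'S_n) i1 i2 :
  mesh12_occ (shading_transpose R) (pi^-1)%g (pi i1) (pi i2) =
  mesh12_occ R pi i1 i2.
Proof.
have imp Q (s : 'S_n) j1 j2 : mesh12_occ Q s j1 j2 ->
    mesh12_occ (shading_transpose Q) (s^-1)%g (s j1) (s j2).
  case/mesh12_occP => lt1 lt2 H; apply/mesh12_occP; rewrite !permK; split=> //.
  move=> ab k; rewrite inE => abR; have /= := H _ ((s^-1)%g k) abR.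
  by rewrite permKV andbC.
apply/idP/idP; last exact: imp.
by move/imp; rewrite shading_transposeK invgK !permK.
Qed.

Definition rev_perm n : 'S_n := perm (@rev_ord_inj n).

Lemma rev_permE n i : rev_perm n i = rev_ord i.
Proof. exact: permE. Qed.

(** The half-turn reverses both orders, so the two points of the occurrence change roles and strip
    [a] becomes [2 - a]. *)
Lemma mesh12_occ_rotate R n (pi : 'S_n) i1 i2 :
  mesh12_occ (shading_rotate R) (rev_perm n * pi * rev_perm n)%g
    (rev_ord i2) (rev_ord i1) = mesh12_occ R pi i1 i2.
Proof.
have imp Q (s : 'S_n) j1 j2 : mesh12_occ Q s j1 j2 ->
    mesh12_occ (shading_rotate Q) (rev_perm n * s * rev_perm n)%g
      (rev_ord j2) (rev_ord j1).
  have gap (u v w : 'I_n) (a : 'I_3) :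
      in_gap (rev_ord v) (rev_ord u) (rev_ord w) a = in_gap u v w (rev_ord a).
    have := ltn_ord u; have := ltn_ord v; have := ltn_ord w.
    by case: a => -[|[|[|//]]] ? /=; lia.
  case/mesh12_occP => lt1 lt2 H; apply/mesh12_occP.
  rewrite !permM !rev_permE !rev_ordK; split.
  - by rewrite /=; have := ltn_ord j1; have := ltn_ord j2; lia.
  - by rewrite /=; have := ltn_ord (s j1); have := ltn_ord (s j2); lia.
  move=> ab k; rewrite inE => abR; have := H _ (rev_ord k) abR.
  by rewrite -(gap _ _ _ ab.1) -(gap _ _ _ ab.2) rev_ordK !permM !rev_permE.
apply/idP/idP; last exact: imp.
move/imp; rewrite shading_rotateK !rev_ordK.
suff -> : (rev_perm n * (rev_perm n * pi * rev_perm n) * rev_perm n = pi)%g by [].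
by apply/permP => i; rewrite !permM !rev_permE !rev_ordK.
Qed.

Lemma mesh12_count_transpose R n (pi : 'S_n) :
  mesh12_count (shading_transpose R) (pi^-1)%g = mesh12_count R pi.
Proof.
rewrite /mesh12_count.
have inj : injective (fun i : 'I_n * 'I_n => (pi i.1, pi i.2)).
  by move=> [i j] [i' j'] [/perm_inj-> /perm_inj->].
rewrite -(card_preimset _ inj); apply: eq_card => i.
by rewrite !inE /= mesh12_occ_transpose.
Qed.

Lemma mesh12_count_rotate R n (pi : 'S_n) :
  mesh12_count (shading_rotate R) (rev_perm n * pi * rev_perm n)%g =
  mesh12_count R pi.
Proof.
rewrite /mesh12_count.
have inj : injective (fun i : 'I_n * 'I_n => (rev_ord i.2, rev_ord i.1)).
  by move=> [i j] [i' j'] /= /pair_equal_spec[/rev_ord_inj-> /rev_ord_inj->].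
rewrite -(card_preimset _ inj); apply: eq_card => i.
by rewrite !inE /= mesh12_occ_rotate.
Qed.

Definition shading_of (s : seq (nat * nat)) : shading :=
  [set ab | (val ab.1, val ab.2) \in s].

(** Encodes a strip as a sum of two booleans, which reduces the shading condition to a finite truth
    table. *)
Lemma in_gapE u v w a : u < v -> a < 3 ->
  in_gap u v w a = [&& w != u, w != v & (u < w) + (v < w) == a].
Proof.
case: a => [|[|[|//]]] ltuv _ /=; case: (ltngtP w u); case: (ltngtP w v) => //=; lia.
Qed.

Lemma mesh12_occ_ofP s n (pi : 'S_n) (i1 i2 : 'I_n) :
  reflect [/\ i1 < i2, pi i1 < pi i2 & forall k, k != i1 -> k != i2 ->
             ((i1 < k) + (i2 < k), (pi i1 < pi k) + (pi i2 < pi k)) \notin s]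
          (mesh12_occ (shading_of s) pi i1 i2).
Proof.
apply: (iffP (mesh12_occP _ _ _ _)) => -[lti ltpi H]; split=> //;
  [move=> k ne1 ne2 | move=> ab k].
  have lt3 (b c : bool) : b + c < 3 by case: b; case: c.
  apply/negP => ks.
  pose ab : 'I_3 * 'I_3 := (Ordinal (lt3 (i1 < k) (i2 < k)),
                            Ordinal (lt3 (pi i1 < pi k) (pi i2 < pi k))).
  have abR : ab \in shading_of s by rewrite inE.
  have /negP[] := H _ k abR; rewrite !in_gapE //.
  by rewrite !eqxx !(inj_eq val_inj) !(inj_eq perm_inj) ne1 ne2.
rewrite inE; apply: contraL; rewrite !in_gapE //= !(inj_eq val_inj).
case/andP => /and3P[ne1 ne2 /eqP<-] /and3P[_ _ /eqP<-].
exact: H.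
Qed.

(** [P] describes the unshaded boxes through comparisons of a point with the two positions ([c1],
    [c2]) and the two values ([r1], [r2]). The implications discard impossible truth values. *)
Lemma mesh12_occ_zoneP (s : seq (nat * nat)) (P : bool -> bool -> bool -> bool -> bool)
    n (pi : 'S_n) (i1 i2 : 'I_n) :
    (forall c1 c2 r1 r2, c2 ==> c1 -> r2 ==> r1 ->
       ((c1 + c2, r1 + r2) \notin s) = P c1 c2 r1 r2) ->
  reflect [/\ i1 < i2, pi i1 < pi i2 & forall k, k != i1 -> k != i2 ->
             P (i1 < k) (i2 < k) (pi i1 < pi k) (pi i2 < pi k)]
          (mesh12_occ (shading_of s) pi i1 i2).
Proof.
move=> EP.
have implt (x y z : nat) : x < y -> (y < z) ==> (x < z).
  by move=> ltxy; apply/implyP/ltn_trans.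
by apply: (iffP (mesh12_occ_ofP _ _ _ _)) => -[lti ltpi H];
  split=> // k ne1 ne2; have := H k ne1 ne2; rewrite EP ?implt.
Qed.

Lemma sfp_countE n (pi : 'S_n) :
  sfp_count pi = #|[set k : 'I_n | (0 < k) && sfp pi k]|.
Proof.
rewrite -sum1_card /sfp_count; case: n pi => [|n] pi.
  by rewrite big_geq // big_pred0 // => -[].
transitivity (\sum_(0 <= k < n.+1) (0 < k) && sfp pi k).
  by rewrite [RHS]big_ltn // add0n; apply: eq_big_nat => -[].
rewrite big_mkord [RHS]big_mkcond; apply: eq_bigr => k _.
by rewrite inE; case: (_ && _).
Qed.

(** Common frame for all representatives: [h] turns a strong fixed point of [sigma] into an
    occurrence in [pi]. *)
Lemma mesh12_count_sfp R n (pi sigma : 'S_n) (h : 'I_n -> 'I_n * 'I_n) :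
    injective h ->
    (forall k : 'I_n, 0 < k -> sfp sigma k -> mesh12_occ R pi (h k).1 (h k).2) ->
    (forall i1 i2, mesh12_occ R pi i1 i2 ->
       exists k : 'I_n, [/\ 0 < k, sfp sigma k & h k = (i1, i2)]) ->
  mesh12_count R pi = sfp_count sigma.
Proof.
move=> injh H1 H2; rewrite sfp_countE -(card_imset _ injh); apply: eq_card.
move=> [i1 i2]; rewrite inE; apply/idP/imsetP => [/H2[k [k0 sk <-]] | [k]].
  by exists k; rewrite // inE k0.
by rewrite inE => /andP[k0 sk] E; have := H1 k k0 sk; rewrite -E.
Qed.

End MeshOccurrences.

(** * One shading from each symmetry orbit *)

(* The numbers in the lemma names are positions in twenty_shadings, from 1. *)
Section Representatives.

Local Open Scope nat_scope.
Variable n : nat.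
Implicit Types pi : 'S_n.+1.


(** Column 0 is shaded, so [i1] is the first position. The open boxes (1,0), (1,1), (2,2) say that
    [i2] is a strong fixed point. *)
Lemma mesh12_count_shading17 pi :
  mesh12_count (shading_of [:: (0,2); (1,2); (0,1); (2,1); (0,0); (2,0)]) pi =
  sfp_count pi.
Proof.
have occP i1 i2 := @mesh12_occ_zoneP
  [:: (0,2); (1,2); (0,1); (2,1); (0,0); (2,0)]
  (fun c1 c2 r1 r2 => c1 && (r2 == c2)) _ pi i1 i2 ltac:(by do 4!case).
apply: (@mesh12_count_sfp _ _ _ _ (fun k => (ord0, k))) => [k k' [] // | k k0 sk | i1 i2].
  have nek0 : ord0 != k by rewrite -(inj_eq val_inj) /=; case: (val k) k0.
  have /sfp_ordP H := sk; apply/occP; split=> // [|j nej0 nejk].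
    by rewrite ord_ltNge ?(inj_eq perm_inj) // -H.
  by rewrite (H _ nejk) eqxx andbT lt0n; apply: nej0.
case/occP => lt1 lt2 H.
have i10 : ord0 = i1.
  apply/eqP/negPn/negP => ne0.
  have ne02 : ord0 != i2 by rewrite -(inj_eq val_inj) /=; case: (val i2) lt1.
  by have := H _ ne0 ne02; rewrite ltn0.
exists i2; split; [by case: (val i2) lt1 | | by rewrite i10].
apply/sfp_ordP => j nej2; have [->|nej1] := eqVneq j i1.
  by rewrite (leq_gtF (ltnW lt1)) (leq_gtF (ltnW lt2)).
by have /andP[_ /eqP] := H _ nej1 nej2.
Qed.

(** The open boxes (0,0), (1,0), (2,2) make [i2] a strong fixed point. Row 1 is shaded, so [pi i1]
    is the value just below [pi i2 = i2]; hence the witness with [k.-1]. *)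
Lemma mesh12_count_shading9 pi :
  mesh12_count (shading_of [:: (0,2); (1,2); (0,1); (1,1); (2,1); (2,0)]) pi =
  sfp_count pi.
Proof.
have occP i1 i2 := @mesh12_occ_zoneP
  [:: (0,2); (1,2); (0,1); (1,1); (2,1); (2,0)]
  (fun c1 c2 r1 r2 => (r2 == c2) && (r1 == r2)) _ pi i1 i2 ltac:(by do 4!case).
have pred_lt (k : 'I_n.+1) : k.-1 < n.+1 := leq_ltn_trans (leq_pred k) (ltn_ord k).
apply: (@mesh12_count_sfp _ _ _ _ (fun k => ((pi^-1)%g (inord k.-1), k))).
- by move=> k k' [].
- move=> k k0 sk; set i := (pi^-1)%g _.
  have Ei : pi i = k.-1 :> nat by rewrite permKV inordK.
  have /sfpP H := sk; have /sfp_ordP H' := sk.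
  have Ek : pi k = k :> nat.
    by have [] := H k; rewrite ltnn; case: ltngtP.
  have lti : i < k by have [<- _] := H i; rewrite Ei prednK.
  apply/occP; split=> // [|j neji nejk]; first by rewrite Ei Ek prednK.
  have nekj : (k == pi j :> nat) = false.
    by rewrite -Ek (inj_eq val_inj) (inj_eq perm_inj) eq_sym (negPf nejk).
  by rewrite -(H' _ nejk) eqxx (H' _ nejk) Ei Ek prednK //= (leq_eqVlt k) nekj.
move=> i1 i2 /occP[lt1 lt2 H].
have si2 : sfp pi i2.
  apply/sfp_ordP => j nej2; have [->|nej1] := eqVneq j i1.
    by rewrite (leq_gtF (ltnW lt1)) (leq_gtF (ltnW lt2)).
  by have /andP[/eqP] := H _ nej1 nej2.
have i20 : 0 < i2 by apply: leq_ltn_trans lt1.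
exists i2; split=> //; congr (_, _); set j := (pi^-1)%g _.
have Ej : pi j = i2.-1 :> nat by rewrite permKV inordK.
(* Row 1 holds no point, so the value [i2.-1] does not exceed [pi i1]; as [pi i1 < i2], the two
   agree. *)
have [//|nej1] := eqVneq j i1; have /sfpP S := si2.
have ltj2 : j < i2 by have [<- _] := S j; rewrite Ej prednK.
have nej2 : j != i2 by rewrite -(inj_eq val_inj) neq_ltn ltj2.
have /andP[/eqP r2 /eqP r1] := H _ nej1 nej2.
have ltpi1 : pi i1 < i2 by have [-> _] := S i1.
apply: (@perm_inj _ pi); apply/val_inj/eqP; rewrite eqn_leq /=.
by rewrite leqNgt r1 r2 (leq_gtF (ltnW ltj2)) Ej -ltnS prednK.
Qed.

(* x |-> - x mod n.+1 fixes 0 and reverses the other values. *)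
Definition opp_perm : 'S_n.+1 := perm (@oppr_inj 'I_n.+1).

Lemma opp_permP (i : 'I_n.+1) :
  i = 0 :> nat /\ opp_perm i = 0 :> nat \/ 0 < i /\ opp_perm i + i = n.+1.
Proof.
rewrite permE /=; have := ltn_ord i; case: (posnP i) => [-> | i0] lti.
  by left; rewrite subn0 modnn.
by right; rewrite modn_small; lia.
Qed.

Lemma opp_perm_gt0 (i : 'I_n.+1) : (0 < opp_perm i) = (0 < i).
Proof. by have := opp_permP i; have := ltn_ord i; lia. Qed.

Lemma opp_perm_lt (i j : 'I_n.+1) : 0 < i -> 0 < j ->
  (opp_perm i < opp_perm j) = (j < i).
Proof. by have := opp_permP i; have := opp_permP j; lia. Qed.

(** Row 0 is shaded, so [pi i1] is 0. The open boxes (0,2), (1,2), (2,1) put every other point after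
    [i2] exactly when it is below; reversing the nonzero values makes [i2] a strong fixed point. *)
Lemma mesh12_count_shading4 pi :
  mesh12_count (shading_of [:: (2,2); (0,1); (1,1); (0,0); (1,0); (2,0)]) pi =
  sfp_count (pi * opp_perm)%g.
Proof.
have occP i1 i2 := @mesh12_occ_zoneP
  [:: (2,2); (0,1); (1,1); (0,0); (1,0); (2,0)]
  (fun c1 c2 r1 r2 => r1 && (r2 == ~~ c2)) _ pi i1 i2 ltac:(by do 4!case).
pose i0 := (pi^-1)%g ord0; have Ei0 : pi i0 = 0 :> nat by rewrite permKV.
have gt0 j : (0 < pi j) = (j != i0).
  by rewrite lt0n -Ei0 (inj_eq val_inj) (inj_eq perm_inj).
have opp0 : opp_perm (pi i0) = 0 :> nat.
  by apply/eqP; rewrite eqn0Ngt opp_perm_gt0 Ei0.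
apply: (@mesh12_count_sfp _ _ _ _ (fun k => (i0, k))) => [k k' [] // | k k0 sk | i1 i2].
  have {sk} H j : j != k -> (k < j) = (opp_perm (pi k) < opp_perm (pi j)).
    by move=> nejk; have /sfp_ordP/(_ j nejk) := sk; rewrite !permM.
  have ne0k : ord0 != k by rewrite -(inj_eq val_inj) /=; case: (val k) k0.
  (* Otherwise [pi * opp_perm] would send [k > 0] to 0, which no strong fixed point allows. *)
  have nek0 : k != i0.
    apply/eqP => E; have := H _ ne0k.
    by rewrite E opp0 opp_perm_gt0 gt0 -E ne0k.
  have ltpk : 0 < pi k by rewrite gt0.
  apply/occP; split=> [||j nej0 nejk]; rewrite ?Ei0 //.
    have ne0 : i0 != k by rewrite eq_sym.
    by rewrite ord_ltNge // H // opp0.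
  have ltpj : 0 < pi j by rewrite gt0.
  rewrite ltpj H // opp_perm_lt //= (@ord_ltNge _ (pi k)) //.
  by rewrite (inj_eq perm_inj) eq_sym.
case/occP => lt1 lt2 H.
have ne2 : i2 != i0 by rewrite -gt0 (leq_ltn_trans _ lt2).
have E1 : i0 = i1.
  apply/eqP/negPn/negP => ne01; have := H _ ne01.
  by rewrite Ei0 ltn0 eq_sym => /(_ ne2).
exists i2; split; [exact: leq_ltn_trans lt1 | | by rewrite E1].
apply/sfp_ordP => j nej2; rewrite !permM; have [->|nej1] := eqVneq j i1.
  by rewrite (leq_gtF (ltnW lt1)) -E1 opp0 ltn0.
have /andP[_ /eqP r2] := H _ nej1 nej2.
rewrite opp_perm_lt ?gt0 // ?E1 // (@ord_ltNge _ (pi j)) ?(inj_eq perm_inj) //.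
by rewrite r2 negbK.
Qed.

(* Writing the values below P as u and those above P as t, u < P < t, cut_fun P
   reorders the values as t < P < u and keeps the order inside u and inside t. *)
Definition cut_fun (P x : 'I_n.+1) : 'I_n.+1 :=
  inord (if x < P then x + n.+1 - P else if x == P :> nat then n - P else x - P.+1).

Lemma cut_funP (P x : 'I_n.+1) :
  [\/ x < P /\ cut_fun P x + P = x + n.+1, x = P :> nat /\ cut_fun P x + P = n |
      P < x /\ cut_fun P x + P.+1 = x].
Proof.
rewrite /cut_fun; have := ltn_ord x; have := ltn_ord P.
by case: (ltngtP x P) => ltxP ltP ltx;
  [constructor 1 | constructor 3 | constructor 2]; rewrite inordK; lia.
Qed.

Lemma cut_fun_inj P : injective (cut_fun P).
Proof.
move=> x y E; apply: val_inj; rewrite /=.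
have := cut_funP P x; have := cut_funP P y; rewrite E.
have := ltn_ord x; have := ltn_ord P; have := ltn_ord y.
by move=> ? ? ? [] ? [] ?; lia.
Qed.

Definition cut_perm (P : 'I_n.+1) : 'S_n.+1 := perm (@cut_fun_inj P).

(* The value n - pi ord_max of recut s pi at s ord_max reveals pi ord_max, so that
   recut s is injective although its last factor depends on pi. *)
Definition recut (s pi : 'S_n.+1) : 'S_n.+1 := (s^-1 * pi * cut_perm (pi ord_max))%g.

Lemma recutE (s pi : 'S_n.+1) i : recut s pi (s i) = cut_fun (pi ord_max) (pi i).
Proof. by rewrite !permM permK permE. Qed.

Lemma recut_inj (s : 'S_n.+1) : injective (recut s).
Proof.
move=> pi pi' E.
have eqP : pi ord_max = pi' ord_max.
  have := congr1 (fun t : 'S_n.+1 => t (s ord_max)) E; rewrite !recutE => {}E.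
  have := cut_funP (pi ord_max) (pi ord_max).
  have := cut_funP (pi' ord_max) (pi' ord_max).
  have := ltn_ord (pi ord_max); have := ltn_ord (pi' ord_max).
  by rewrite E => ? ? [] ? [] ?; apply: val_inj => /=; lia.
by move: E; rewrite /recut eqP => /mulIg/mulgI.
Qed.

Definition succ_perm : 'S_n.+1 := perm (@ordS_inj n.+1).

Lemma succ_permP (i : 'I_n.+1) :
  i = n :> nat /\ succ_perm i = 0 :> nat \/ i < n /\ succ_perm i = i.+1 :> nat.
Proof.
rewrite permE /=; have := ltn_ord i; rewrite ltnS leq_eqVlt.
case/predU1P => [->|ltin]; first by left; rewrite modnn.
by right; rewrite modn_small.
Qed.

Lemma cut_fun_lt (P x y : 'I_n.+1) : x < P -> y != P ->
  (cut_fun P x < cut_fun P y) = (x < y) && ~~ (P < y).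
Proof.
rewrite -(inj_eq val_inj) neq_ltn /= => ltxP neyP.
have := ltn_ord y; case: (cut_funP P x) => -[h1 h2]; case: (cut_funP P y) => -[h3 h4]; lia.
Qed.

Lemma cut_fun_lt_cut (P x : 'I_n.+1) : x != P ->
  (cut_fun P x < cut_fun P P) = (P < x).
Proof.
rewrite -(inj_eq val_inj) neq_ltn /= => nexP.
have := ltn_ord x; case: (cut_funP P x) => -[h1 h2]; case: (cut_funP P P) => -[h3 h4]; lia.
Qed.

(** Column 2 is shaded, so [i2] is the last position. The last hypothesis makes row 1 consist of the
    points that [s] places after [i1]; by [cut_fun_lt] these are the points that the cut puts above
    [i1]. The last point, sent to the front by [s], ends below [i1] exactly when [pi i1 < pi i2].
    Together this says that [s i1] is a strong fixed point of [recut s pi]. *)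
Lemma mesh12_count_recut (t : seq (nat * nat)) (s pi : 'S_n.+1) :
    s ord_max = ord0 ->
    (forall r : bool * bool, (2, r.1 + r.2) \in t) ->
    (forall (i j : 'I_n.+1) (r1 r2 : bool),
       i != ord_max -> j != i -> j != ord_max -> r2 ==> r1 ->
       ((i < j : nat, r1 + r2) \notin t) = ((s i < s j) == r1 && ~~ r2)) ->
  mesh12_count (shading_of t) pi = sfp_count (recut s pi).
Proof.
move=> s0 tlast tE.
have leq_max (i : 'I_n.+1) : (@ord_max n < i) = false.
  by rewrite ltnNge leq_ord.
have implt i j : pi i < pi ord_max -> (pi ord_max < pi j) ==> (pi i < pi j).
  by move=> ltij; apply/implyP/ltn_trans.
apply: (@mesh12_count_sfp _ _ _ _ (fun k => ((s^-1)%g k, ord_max))).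
- by move=> k k' [] /perm_inj.
- move=> k; rewrite -[k](permKV s); move: (_ k) => {k} i; rewrite permK.
  move=> i0 sk.
  have {sk} H j : j != i ->
      (s i < s j) = (cut_fun (pi ord_max) (pi i) < cut_fun (pi ord_max) (pi j)).
    by move=> neji; have /sfp_ordP/(_ (s j)) := sk; rewrite (inj_eq perm_inj) !recutE => ->.
  have neim : i != ord_max by apply: contraTneq i0 => ->; rewrite s0.
  have ltpi : pi i < pi ord_max.
    rewrite ord_ltNge ?(inj_eq perm_inj) // -cut_fun_lt_cut ?(inj_eq perm_inj) //.
    by rewrite -H 1?eq_sym // s0.
  apply/mesh12_occ_ofP; split=> // [|j neji nejm].
    by rewrite ord_ltNge // leq_max.
  rewrite leq_max addn0 tE ?implt // H // cut_fun_lt //.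
  by rewrite (inj_eq perm_inj).
move=> i1 i2 /mesh12_occ_ofP[lt1 lt2 H].
have i2m : i2 = ord_max.
  apply/eqP/negPn/negP => ne2m.
  have lt2m : i2 < @ord_max n by rewrite ord_ltNge ?leq_max.
  have lt1m := ltn_trans lt1 lt2m.
  have := H ord_max; rewrite lt1m lt2m -!(inj_eq val_inj) !neq_ltn lt1m lt2m !orbT.
  by move=> /(_ isT isT)/negP[]; apply: (tlast (_, _)).
move: lt1 lt2 H; rewrite {}i2m => lt1 lt2 H.
have ne1m : i1 != ord_max by rewrite -(inj_eq val_inj) neq_ltn lt1.
exists (s i1); rewrite permK; split=> //.
  by rewrite lt0n -[0]/(val (@ord0 n)) (inj_eq val_inj) -s0 (inj_eq perm_inj).
apply/sfp_ordP => j; rewrite -[j](permKV s) (inj_eq perm_inj) !recutE.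
move: (_ j) => {}j nej1; have [->|nejm] := eqVneq j ord_max.
  by rewrite s0 cut_fun_lt_cut ?(inj_eq perm_inj) // (leq_gtF (ltnW lt2)).
rewrite cut_fun_lt ?(inj_eq perm_inj) //.
by have := H _ nej1 nejm; rewrite leq_max addn0 tE ?implt // => /eqP.
Qed.

(** The open boxes (0,0), (0,2), (1,1) put row 1 after [i1], so [s] keeps the order of positions and
    only moves the last one to the front. *)
Lemma mesh12_count_shading7 pi :
  mesh12_count (shading_of [:: (1,2); (2,2); (0,1); (2,1); (1,0); (2,0)]) pi =
  sfp_count (recut succ_perm pi).
Proof.
apply: mesh12_count_recut => [|[[] []] //|i j r1 r2 neim neji nejm].
  by apply: val_inj => /=; case: (succ_permP ord_max) => -[] //=; rewrite ltnn.
have succE k : k != ord_max -> succ_perm k = k.+1 :> nat.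
  case: (succ_permP k) => -[] // kn _ /negP[].
  by apply/eqP/val_inj.
by rewrite !succE // ltnS; case: (i < j); case: r1; case: r2.
Qed.

(** The open boxes (0,1), (1,0), (1,2) put row 1 before [i1], so [s] reverses the positions. *)
Lemma mesh12_count_shading15 pi :
  mesh12_count (shading_of [:: (0,2); (2,2); (1,1); (2,1); (0,0); (2,0)]) pi =
  sfp_count (recut (rev_perm n.+1) pi).
Proof.
apply: mesh12_count_recut => [|[[] []] //|i j r1 r2 _ neji _].
  by apply: val_inj; rewrite rev_permE /= subnn.
have -> : (rev_perm n.+1 i < rev_perm n.+1 j) = ~~ (i < j).
  rewrite !rev_permE -ord_ltNge //=.
  by have := ltn_ord i; have := ltn_ord j; lia.
by case: (i < j); case: r1; case: r2.
Qed.

End Representatives.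

(** * Generating functions of the twenty shadings *)

Section MeshSeries.

Variables (K : comUnitRingType) (q : K).

Definition mesh_gf (R : shading) (n : nat) : K :=
  \sum_(pi : 'S_n) q ^+ mesh12_count R pi.

Lemma mesh_gf_transpose R : mesh_gf (shading_transpose R) =1 mesh_gf R.
Proof.
move=> n; rewrite /mesh_gf.
rewrite (reindex_inj (@invg_inj _ : injective (fun pi : 'S_n => pi^-1)%g)).
by apply: eq_bigr => pi _; rewrite mesh12_count_transpose.
Qed.

Lemma mesh_gf_rotate R : mesh_gf (shading_rotate R) =1 mesh_gf R.
Proof.
move=> n; rewrite /mesh_gf.
rewrite (reindex_inj (inj_comp (mulIg (rev_perm n)) (mulgI (rev_perm n)))) /=.
by apply: eq_bigr => pi _; rewrite mesh12_count_rotate.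
Qed.

Lemma mesh_gf_sfp R (f : forall n, 'S_n.+1 -> 'S_n.+1) :
    (forall n, injective (f n)) ->
    (forall n (pi : 'S_n.+1), mesh12_count R pi = sfp_count (f n pi)) ->
  mesh_gf R =1 sfp_gf q.
Proof.
move=> injf Ef [|n].
  apply: eq_bigr => pi _; rewrite /sfp_count big_geq //.
  by rewrite /mesh12_count eq_card0 // => -[[]].
rewrite /sfp_gf (reindex_inj (injf n)).
by apply: eq_bigr => pi _; rewrite Ef.
Qed.

Definition representatives : seq shading := [::
  shading_of [:: (0,2); (1,2); (0,1); (2,1); (0,0); (2,0)]%N;
  shading_of [:: (0,2); (1,2); (0,1); (1,1); (2,1); (2,0)]%N;
  shading_of [:: (2,2); (0,1); (1,1); (0,0); (1,0); (2,0)]%N;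
  shading_of [:: (1,2); (2,2); (0,1); (2,1); (1,0); (2,0)]%N;
  shading_of [:: (0,2); (2,2); (1,1); (2,1); (0,0); (2,0)]%N].

Lemma mesh_gf_representatives R : R \in representatives -> mesh_gf R =1 sfp_gf q.
Proof.
rewrite !inE => /or4P[/eqP->|/eqP->|/eqP->|/orP[]/eqP->].
- apply: (@mesh_gf_sfp _ (fun _ pi => pi)) => [n pi pi' | n pi] //.
  exact: mesh12_count_shading17.
- apply: (@mesh_gf_sfp _ (fun _ pi => pi)) => [n pi pi' | n pi] //.
  exact: mesh12_count_shading9.
- apply: (@mesh_gf_sfp _ (fun n pi => pi * opp_perm n)%g) => [n|n pi].
    exact: mulIg.
  exact: mesh12_count_shading4.
- apply: (@mesh_gf_sfp _ (fun n => recut (succ_perm n))) => [n|n pi].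
    exact: recut_inj.
  exact: mesh12_count_shading7.
- apply: (@mesh_gf_sfp _ (fun n => recut (rev_perm n.+1))) => [n|n pi].
    exact: recut_inj.
  exact: mesh12_count_shading15.
Qed.

Definition shading_orbit (R : shading) : seq shading :=
  [:: R; shading_transpose R; shading_rotate R; shading_transpose (shading_rotate R)].

(** Index [4 * r + g] selects image [g] in the orbit of representative [r], both counted from 0;
    every index below 20 occurs once. *)
Lemma twenty_shadingsE : twenty_shadings =
  [seq nth set0 (flatten [seq shading_orbit R | R <- representatives]) i |
    i <- [:: 10; 9; 11; 8; 13; 14; 12; 15; 4; 7;
             5; 6; 17; 18; 16; 19; 0; 3; 2; 1]%N].
Proof.
rewrite /twenty_shadings /=; do 20!(congr (_ :: _); first by
  apply/setP => -[[[|[|[|//]]] ?] [[|[|[|//]]] ?]]; rewrite !inE).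
Qed.

Lemma mesh_gf_twenty R : R \in twenty_shadings -> mesh_gf R =1 sfp_gf q.
Proof.
rewrite twenty_shadingsE => /mapP[i lti ->].
have /flatten_mapP[R0 /mesh_gf_representatives E] :
    nth set0 (flatten [seq shading_orbit R0 | R0 <- representatives]) i
      \in flatten [seq shading_orbit R0 | R0 <- representatives].
  by apply: mem_nth; move: i lti; apply/allP.
move: (nth _ _ _) => {}R; rewrite !inE => /or4P[]/eqP-> n.
- exact: E.
- by rewrite mesh_gf_transpose.
- by rewrite mesh_gf_rotate.
- by rewrite mesh_gf_transpose mesh_gf_rotate.
Qed.

End MeshSeries.

(** * Specialization to ['X] and to 0, and the theorem *)

Lemma coef_mesh_gf R n k :
  (mesh_gf 'X R n : {poly int})`_k = (mesh12_num R n k)%:R.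
Proof.
rewrite /mesh_gf coef_sum /mesh12_num -sum1_card natr_sum [RHS]big_mkcond.
by apply: eq_bigr => pi _; rewrite coefXn inE eq_sym; case: eqP.
Qed.

(** Since [0 ^+ 0 = 1], setting q to 0 keeps exactly the avoiders. *)
Lemma avoid_gfE R : avoid_gf R =1 mesh_gf 0 R.
Proof.
move=> n; rewrite /avoid_gf /mesh12_num -sum1_card natr_sum [LHS]big_mkcond.
by apply: eq_bigr => pi _; rewrite inE expr0n; case: eqP.
Qed.

Theorem theorem3p16 :
  (forall R1 R2 : shading, R1 \in twenty_shadings -> R2 \in twenty_shadings ->
     equidistributed R1 R2) /\
  (forall R : shading, R \in twenty_shadings ->
     avoid_gf R =1
       ((1 + fps_X) * fact_gf / (1 + fps_X * fact_gf))%fps /\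
     mesh12_gf R =1
       ((1 + fps_X * fps_const (1 - 'X)%R) * fact_gf /
        (1 + fps_X * fps_const (1 - 'X)%R * fact_gf))%fps).
Proof.
split=> [R1 R2 R1in R2in n k | R Rin].
  have := congr1 (fun p : {poly int} => p`_k) (mesh_gf_twenty 'X R1in n).
  rewrite /= -(mesh_gf_twenty 'X R2in n) !coef_mesh_gf => /eqP.
  by rewrite Num.Theory.eqr_nat => /eqP.
split=> n.
  rewrite avoid_gfE (mesh_gf_twenty 0 Rin); apply: sfp_gf_series => i.
  by rewrite subr0.
rewrite -[LHS]/(mesh_gf 'X R n) (mesh_gf_twenty 'X Rin); apply: sfp_gf_series.
(* The product of [fps_X] with the constant [1 - 'X] has its only nonzero coefficient in degree
   1. *)
move=> [|[|i]]; rewrite /fps_mul.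
- by rewrite big_ord1 mul0r.
- by rewrite big_ord_recl mul0r add0r big_ord1 mul1r.
rewrite big1 // => j _; rewrite /fps_X /fps_const.
case: eqP => [->|_]; last by rewrite mul0r.
by rewrite mul1r.
Qed.
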